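(* Let $\Sigma$ be a simple signed graph with maximum degree $\Delta(\Sigma)$. Then there is a linear oriented hypergraph $H$ with $\Lambda(H)=\Sigma$. Moreover, for every integer $k\ge\Delta(\Sigma)$ there exists a $k$-uniform linear oriented hypergraph $H_k$ with $\Lambda(H_k)=\Sigma$.
   Context: A hypergraph $(V,E,\mathcal I)$ consists of a finite set $V$ of vertices, a finite family $E=(e_\iota)_{\iota\in\Omega}$ of subsets of $V$ (the edges; an edge may be empty, and edges with different indices are regarded as different even if they coincide as sets) and its incidences $\mathcal I$. All hypergraphs are simple: each vertex $v\in e$ is incident with $e$ exactly once, so $\mathcal I=\{(v,e): v\in e\}$. A hypergraph is linear if $|e\cap f|\le 1$ for any two edges $e,f$ with distinct indices; it is $k$-uniform if every edge has exactly $k$ elements. An oriented hypergraph is a hypergraph together with a map $\sigma:\mathcal I\to\{+1,-1\}$; hypergraph terminology for an oriented hypergraph refers to its underlying hypergraph. Intersection graph: for a linear oriented hypergraph $G$, $\Lambda(G)$ is the ($2$-uniform linear) oriented hypergraph with vertex set $E(G)$ and one edge $ef=\{e,f\}$ for each pair of distinct $e,f\in E(G)$ with $e\cap f\ne\varnothing$; if $v\in e\cap f$ then $\sigma_{\Lambda(G)}(e,ef)=\sigma_G(v,e)$ and $\sigma_{\Lambda(G)}(f,ef)=\sigma_G(v,f)$. A simple signed graph $\Sigma=(\Gamma,\mathrm{sgn})$ is a finite graph $\Gamma$ without loops or multiple edges together with a map $\mathrm{sgn}:E(\Gamma)\to\{+1,-1\}$; $\Delta(\Sigma)$ is the maximum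 vertex degree of $\Gamma$. A $2$-uniform linear oriented hypergraph $(\Gamma,\beta)$ is regarded as an orientation of the signed graph on $\Gamma$ whose edge $e$ with endpoints $v_i,v_j$ has sign $\mathrm{sgn}(e)=-\beta(v_i,e)\beta(v_j,e)$. For an oriented hypergraph $H$, $\Lambda(H)=\Sigma$ means that $\Lambda(H)$ is an orientation of $\Sigma$: it has the same vertices and edges as $\Sigma$ (with edge $ef$ of $\Lambda(H)$ identified with the pair $\{e,f\}$ and edges of $H$ identified with vertices of $\Sigma$), and the induced edge signs are those of $\Sigma$. *)

(* Defs.v *)
From mathcomp Require Import all_boot all_order all_algebra.

Set Implicit Arguments.
Unset Strict Implicit.
Unset Printing Implicit Defensive.

(* A hypergraph with vertex set V is a family of subsets of V indexed by Om.  *)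
(* Edges are referred to by their index, so E(G) is Om.  Hypergraphs are      *)
(* simple, so the incidences are the pairs (v, e) with v \in G e.             *)
Record hypergraph (V Om : finType) := Hypergraph { edge :> Om -> {set V} }.

Definition linear_hypergraph (V Om : finType) (G : hypergraph V Om) : Prop :=
  forall e f : Om, e != f -> #|G e :&: G f| <= 1.

Definition uniform_hypergraph (V Om : finType) (k : nat)
    (G : hypergraph V Om) : Prop :=
  forall e : Om, #|G e| = k.

Definition is_sign (s : int) : Prop := s = 1%R \/ s = (-1)%R.

(* Only the values of osign at incidences are meaningful. *)
Record oriented_hypergraph (V Om : finType) := OrientedHypergraph {
  underlying :> hypergraph V Om;
  osign : V -> Om -> int;
  osignP : forall v e, v \in underlying e -> is_sign (osign v e)
}.

Section IntersectionGraph.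
Variables (V Om : finType) (G : oriented_hypergraph V Om).

Definition common_vertices (A : {set Om}) : {set V} := \bigcap_(e in A) G e.

(* The pairs {e, f} of distinct edges with a common vertex. *)
Definition intersecting_pair (A : {set Om}) : bool :=
  (#|A| == 2) && (common_vertices A != set0).

Definition Lambda_edge : finType := {A : {set Om} | intersecting_pair A}.

(* The sign at (e, ef) is that of (v, e) for v a vertex of the intersection   *)
(* of e and f, which is unique when G is linear (see Lambda_osign).           *)
Definition Lambda_sign (e : Om) (ef : Lambda_edge) : int :=
  if [pick v in common_vertices (val ef)] is Some v then osign G v e else 1%R.

Lemma Lambda_signP (e : Om) (ef : Lambda_edge) :
  e \in val ef -> is_sign (Lambda_sign e ef).
Proof.
move=> e_ef; rewrite /Lambda_sign; case: pickP => [v /bigcapP vP | _]; last by left.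
exact/osignP/vP.
Qed.

Definition Lambda : oriented_hypergraph Om Lambda_edge :=
  @OrientedHypergraph Om Lambda_edge (Hypergraph val) Lambda_sign Lambda_signP.

Lemma Lambda_osign (e f : Om) (ef : Lambda_edge) (v : V) :
  linear_hypergraph G -> e != f -> val ef = [set e; f] ->
  v \in G e :&: G f -> osign Lambda e ef = osign G v e.
Proof.
move=> linG neq_ef def_ef vef; rewrite /= /Lambda_sign /common_vertices def_ef.
have -> : \bigcap_(g in [set e; f]) G g = G e :&: G f.
  by rewrite bigcap_setU !big_set1.
case: pickP => [w wef | /(_ v)]; last by rewrite vef.
by rewrite (card_le1_eqP (linG _ _ neq_ef) w v).
Qed.

Lemma Lambda_edgeP (e f : Om) : e != f ->
  (exists ef : Lambda_edge, Lambda ef = [set e; f]) <-> G e :&: G f != set0.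
Proof.
move=> neq_ef; have cE : common_vertices [set e; f] = G e :&: G f.
  by rewrite /common_vertices bigcap_setU !big_set1.
split=> [[[A /= /andP[_ cA]] defA] | ef0]; first by rewrite -cE -defA.
have pef : intersecting_pair [set e; f] by rewrite /intersecting_pair cards2 neq_ef cE.
by exists (Sub [set e; f] pef : Lambda_edge).
Qed.

Lemma Lambda_uniform : uniform_hypergraph 2 Lambda.
Proof. by case=> A /= /andP[/eqP]. Qed.

Lemma Lambda_linear : linear_hypergraph Lambda.
Proof.
move=> i j neq_ij; rewrite leqNgt; apply: contra neq_ij => lt1.
have sub_eq (k : Lambda_edge) : val i :&: val j \subset val k -> val i :&: val j = val k.
  by move=> sub; apply/eqP; rewrite eqEcard sub (Lambda_uniform k).
by rewrite -val_eqE /= -(sub_eq i) ?subsetIl// (sub_eq j) ?subsetIr.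
Qed.

End IntersectionGraph.

Record signed_graph (T : finType) := SignedGraph {
  sedges : {set {set T}};
  sedges2 : forall e, e \in sedges -> #|e| = 2;
  sgn : {set T} -> int; (* only the values on sedges are meaningful *)
  sgnP : forall e, e \in sedges -> is_sign (sgn e)
}.

Definition degree (T : finType) (S : signed_graph T) (x : T) : nat :=
  #|[set e in sedges S | x \in e]|.

Definition max_degree (T : finType) (S : signed_graph T) : nat :=
  \max_(x : T) degree S x.

(* B is an orientation of S: the two have the same vertices and edges, and    *)
(* the edge signs induced by B are those of S.                                *)
Definition is_orientation (T P : finType) (B : oriented_hypergraph T P)
    (S : signed_graph T) : Prop :=
  [/\ uniform_hypergraph 2 B,
      linear_hypergraph B,
      [set B i | i : P] = sedges S
    & forall (i : P) (x y : T), x != y -> B i = [set x; y] ->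
        sgn S (B i) = (- (osign B x i * osign B y i))%R].

(* Main.v *)
(* Take the edges of S as vertices and let the hyperedge of x be the set of   *)
(* edges of S at x, padded with vertices private to x up to size k.  Two      *)
(* hyperedges x and y then meet at most in {x, y}, and do so exactly when     *)
(* {x, y} is an edge of S.  At each edge e of S, one endpoint gets the sign   *)
(* - sgn e and the other one the sign 1.                                      *)
Require Import Defs.
From mathcomp Require Import all_boot all_order all_algebra.

Set Implicit Arguments.
Unset Strict Implicit.
Unset Printing Implicit Defensive.

(** The hypergraph is the dual of the graph of [S]. Since [S] is simple, distinct vertices [x], [y]
    share at most the edge {x, y}, and private vertices add nothing to an intersection; [dual_edgeI]
    thus gives both linearity and, via [padded_dual_meet], the adjacencies of [S]. The signs at {x,
    y} multiply to minus its sign ([dual_sign_mul]), which the minus in the induced sign undoes.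
    Only uniformity needs [k] to bound the degrees. *)

Section PaddedDual.
Variables (T : finType) (S : signed_graph T) (k : nat).

(** Sets that are not edges of [S] become isolated vertices, as do the surplus private vertices
    [inr (x, i)] with [k - degree S x <= i]. *)
Definition dual_vertex : finType := ({set T} + T * 'I_k)%type.

Definition dual_edge (x : T) : {set dual_vertex} :=
  [set v : dual_vertex | match v with
    | inl e => (e \in sedges S) && (x \in e)
    | inr (y, i) => (y == x) && (i < k - degree S x)
    end].

(** The [pick] depends on [e] alone, so both endpoints agree on which of them carries
    [- sgn S e]. *)
Definition dual_sign (v : dual_vertex) (x : T) : int :=
  if v is inl e then
    if [pick y in e] == Some x then (- sgn S e)%R else 1%R
  else 1%R.

Lemma dual_signP v x : v \in dual_edge x -> is_sign (dual_sign v x).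
Proof.
case: v => [e|?] /=; last by left.
rewrite inE => /andP[eS _]; case: ifP => _; last by left.
by case: (sgnP eS) => ->; [right | left; rewrite GRing.opprK].
Qed.

Definition padded_dual : oriented_hypergraph dual_vertex T :=
  @OrientedHypergraph _ _ (Hypergraph dual_edge) dual_sign dual_signP.

Lemma pair_eq (e : {set T}) x y :
  e \in sedges S -> x != y -> x \in e -> y \in e -> e = [set x; y].
Proof.
move=> eS nxy xe ye; apply/esym/eqP.
by rewrite eqEcard subUset !sub1set xe ye cards2 nxy (sedges2 eS).
Qed.

Lemma dual_edgeI x y : x != y ->
  dual_edge x :&: dual_edge y =
    [set v : dual_vertex | (v == inl [set x; y]) && ([set x; y] \in sedges S)].
Proof.
move=> nxy; apply/setP => -[e|[z i]]; rewrite !inE /=.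
  apply/idP/andP => [/andP[/andP[eS xe] /andP[_ ye]]|[/eqP[->] ->]].
    by rewrite -(pair_eq eS nxy xe ye) eqxx.
  by rewrite set21 set22.
by apply/negP => /andP[/andP[/eqP-> _] /andP[/eqP exy _]]; rewrite exy eqxx in nxy.
Qed.

Lemma padded_dual_linear : linear_hypergraph padded_dual.
Proof.
move=> x y nxy; rewrite /= dual_edgeI // -(cards1 (inl [set x; y] : dual_vertex)).
by apply/subset_leq_card/subsetP => v; rewrite !inE => /andP[].
Qed.

Lemma padded_dual_uniform : max_degree S <= k -> uniform_hypergraph k padded_dual.
Proof.
move=> lek x /=; have dk : degree S x <= k.
  exact: leq_trans (leq_bigmax (F := degree S) x) lek.
have inlI : injective (inl : {set T} -> dual_vertex) by move=> ? ? [].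
pose h (i : 'I_(k - degree S x)) : dual_vertex :=
  inr (x, widen_ord (leq_subr _ _) i).
have hI : injective h by move=> i j [] ij; apply: val_inj.
have -> : dual_edge x =
    inl @: [set e in sedges S | x \in e] :|: h @: setT.
  apply/setP => -[e|[y i]]; rewrite !inE.
    rewrite mem_imset // inE; apply/idP/orP => [|[//|/imsetP[]//]]; by left.
  apply/andP/orP => [[/eqP-> lti]|[/imsetP[]//|/imsetP[j _ [-> ->]]]].
    by right; apply/imsetP; exists (Ordinal lti) => //; congr inr; congr pair; apply: val_inj.
  by rewrite eqxx /=.
(* The two images are disjoint, of sizes [degree S x] and [k - degree S x]; by [dk] the subtraction
   does not truncate. *)
rewrite cardsU disjoint_setI0 ?cards0 ?subn0.
  by rewrite !card_imset // cardsT card_ord subnKC.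
by rewrite disjoint_subset; apply/subsetP => _ /imsetP[e _ ->]; rewrite inE; apply/imsetP => -[].
Qed.

Lemma padded_dual_meet x y : x != y ->
  (padded_dual x :&: padded_dual y != set0) = ([set x; y] \in sedges S).
Proof.
move=> nxy; rewrite /= dual_edgeI //.
apply/set0Pn/idP => [[v]|eS]; first by rewrite inE => /andP[].
by exists (inl [set x; y]); rewrite inE eqxx.
Qed.

Lemma dual_sign_mul (x y : T) : x != y ->
  (dual_sign (inl [set x; y]) x * dual_sign (inl [set x; y]) y)%R
    = (- sgn S [set x; y])%R.
Proof.
move=> nxy /=; case: pickP => [z|/(_ x)]; last by rewrite set21.
rewrite !(inj_eq Some_inj) => /set2P[] ->; rewrite eqxx.
  by rewrite (negbTE nxy) GRing.mulr1.
by rewrite eq_sym (negbTE nxy) GRing.mul1r.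
Qed.

Lemma padded_dual_orientation : is_orientation (Lambda padded_dual) S.
Proof.
split; [exact: Lambda_uniform | exact: Lambda_linear | |].
  apply/setP => A; apply/imsetP/idP => [[ef _ ->]|AS].
    have /eqP/cards2P[x [y [nxy def_ef]]] := Lambda_uniform ef.
    by rewrite def_ef -(padded_dual_meet nxy); apply/Lambda_edgeP => //; exists ef.
  have /eqP/cards2P[x [y [nxy defA]]] := sedges2 AS.
  have [ef def_ef] : exists ef, Lambda padded_dual ef = [set x; y].
    by apply/Lambda_edgeP; rewrite ?padded_dual_meet -?defA.
  by exists ef; rewrite ?def_ef.
move=> ef x y nxy def_ef; rewrite def_ef.
have xyS : [set x; y] \in sedges S.
  by rewrite -(padded_dual_meet nxy); apply/Lambda_edgeP => //; exists ef.
have vxy : inl [set x; y] \in padded_dual x :&: padded_dual y.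
  by rewrite /= dual_edgeI // inE eqxx.
rewrite (Lambda_osign padded_dual_linear nxy def_ef vxy).
(* [Lambda_osign] reads the sign at its first edge, so the sign at [y] needs the roles of [x] and
   [y] swapped. *)
rewrite (Lambda_osign (f := x) (v := inl [set x; y]) padded_dual_linear).
- by rewrite dual_sign_mul // GRing.opprK.
- by rewrite eq_sym.
- by rewrite setUC; exact: def_ef.
- by rewrite setIC.
Qed.

End PaddedDual.

Theorem theorem3p6 (T : finType) (S : signed_graph T) :
  (exists (V : finType) (H : oriented_hypergraph V T),
     linear_hypergraph H /\ is_orientation (Lambda H) S) /\
  (forall k : nat, max_degree S <= k ->
     exists (V : finType) (H : oriented_hypergraph V T),
       [/\ linear_hypergraph H, uniform_hypergraph k H
         & is_orientation (Lambda H) S]).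
Proof.
split=> [|k lek].
  (* With [k = 0] there are no private vertices: this is the plain dual. *)
  exists (dual_vertex T 0), (padded_dual S 0).
  by split; [exact: padded_dual_linear | exact: padded_dual_orientation].
exists (dual_vertex T k), (padded_dual S k).
split; [exact: padded_dual_linear | exact: padded_dual_uniform |].
exact: padded_dual_orientation.
Qed.
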